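(* For a skew category system $(A,G,\sigma)$ with $A$ commutative and its skew category algebra $A\rtimes^{\sigma}G$, consider the assertions: (i) if $I$ is a nonzero (two-sided) ideal of $A\rtimes^{\sigma}G$, then $I\cap A\neq\{0\}$; (ii) the subring $A$ is maximal commutative in $A\rtimes^{\sigma}G$. Then: (a) for every skew category system $(A,G,\sigma)$ with $A$ commutative, (i) implies (ii); (b) (ii) does not imply (i) for all categories $G$, i.e. there exists a skew category system $(A,G,\sigma)$ with $A$ commutative for which (ii) holds but (i) fails; (c) for every skew category system $(A,G,\sigma)$ with $A$ commutative and $G$ a groupoid, (i) holds if and only if (ii) holds.
   Context: For a morphism $n$ of a category $G$, $d(n)$ and $c(n)$ denote its domain and codomain; objects are identified with their identity morphisms; $mn$ is defined when $d(m)=c(n)$. Rings are associative; unital rings have nonzero identity, and homomorphisms between unital rings preserve identities. A skew category system is a triple $(A,G,\sigma)$ where $G$ is a small category, $A=\bigoplus_{e\in\mathrm{ob}(G)}A_e$ is a direct sum of unital rings $A_e$, and $\sigma$ is a functor from $G$ to the category of unital rings with $\sigma(n): A_{d(n)}\to A_{c(n)}$ for each morphism $n$; that is, $\sigma(e)=\mathrm{id}_{A_e}$ and $\sigma(m)\sigma(n)=\sigma(mn)$ whenever $d(m)=c(n)$. The skew category algebra $A \rtimes^{\sigma} G$ is the set of formal sums $\sum_{n\in G} a_n u_n$ over morphisms $n$ of $G$, with $a_n \in A_{c(n)}$ and $a_n = 0$ for all but finitely many $n$, with componentwise addition and multiplication $$\Big(\sum_{n} a_n u_n\Big)\Big(\sum_{n}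 b_n u_n\Big) = \sum_{n} \Big(\sum_{mm'=n,\ d(m)=c(m')} a_m\,\sigma(m)(b_{m'})\Big) u_n .$$ $A$ is regarded as a subring via $\sum_e a_e \mapsto \sum_{e} a_e u_e$. A commutative subring is maximal commutative if it equals its commutant (the set of elements of the big ring commuting with all its elements). *)

(* Defs.v *)
From HB Require Import structures.
From mathcomp Require Import all_boot all_order all_algebra.
From mathcomp Require Import mathcomp_extra boolp classical_sets functions.
From mathcomp Require Import cardinality fsbigop.

Set Implicit Arguments.
Unset Strict Implicit.
Unset Printing Implicit Defensive.

Import GRing.Theory.
Local Open Scope classical_set_scope.
Local Open Scope ring_scope.

Record category := Category {
  ob :> Type;
  hom : ob -> ob -> Type;
  idm : forall e, hom e e;
  (* [compm m n] is the product mn, defined when d(m) = c(n). *)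
  compm : forall x y z, hom y z -> hom x y -> hom x z;
  compm1 : forall x y (n : hom x y), compm n (idm x) = n;
  comp1m : forall x y (n : hom x y), compm (idm y) n = n;
  compmA : forall w x y z (l : hom y z) (m : hom x y) (n : hom w x),
    compm l (compm m n) = compm (compm l m) n }.

Arguments idm {c}.

Definition is_groupoid (G : category) : Prop :=
  forall (x y : G) (n : hom x y),
    exists m : hom y x, compm m n = idm x /\ compm n m = idm y.

Record mor (G : category) := Mor { dom : G; cod : G; arr : hom dom cod }.

Arguments Mor {G dom cod}.

Lemma Mor_inj (G : category) (x y : G) (m m' : hom x y) :
  Mor m = Mor m' -> m = m'.
Proof.
move=> e.
pose tr (k : mor G) (ed : dom k = x) (ec : cod k = y) : hom x y :=
  let: erefl := ec in let: erefl := ed in arr k.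
have trE k ed ec : k = Mor m -> tr k ed ec = m.
  move=> ek; subst k.
  by rewrite (Prop_irrelevance ed erefl) (Prop_irrelevance ec erefl).
by rewrite -(trE (Mor m') erefl erefl).
Qed.

Record factorization (G : category) (n : mor G) := Factorization {
  mid : G;
  lfact : hom mid (cod n);
  rfact : hom (dom n) mid;
  factE : compm lfact rfact = arr n }.

Definition factors (G : category) (n : mor G) (p : factorization n) :=
  (Mor (lfact p), Mor (rfact p)).

Lemma factors_mor (G : category) (n n' : mor G)
    (p : factorization n) (q : factorization n') :
  factors p = factors q -> n = n'.
Proof.
case: n n' p q => [d c a] [d' c' a'] [k l r /= e] [k' l' r' /= e'].
move=> epq; have [/= el er] := (congr1 fst epq, congr1 snd epq).
have [/= ek ec] := (congr1 (@dom G) el, congr1 (@cod G) el).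
have /= ed := congr1 (@dom G) er; subst k' c' d'.
by rewrite -e -e' (Mor_inj el) (Mor_inj er).
Qed.

Lemma factors_inj (G : category) (n : mor G) : injective (@factors G n).
Proof.
case: n => d c a [k l r /= e] [k' l' r' /= e'] epq.
have [/= el er] := (congr1 fst epq, congr1 snd epq).
have /= ek := congr1 (@dom G) el; subst k'.
move: (Mor_inj el) (Mor_inj er) => ? ?; subst l' r'.
by rewrite (Prop_irrelevance e e').
Qed.

Section DirectSum.
Variables (I : Type) (V : I -> zmodType).

Record dsum := DSum {
  dsum_fun :> forall i, V i;
  dsum_fin : finite_set [set i | dsum_fun i != 0] }.

Lemma dsumP (f g : dsum) : (forall i, f i = g i) -> f = g.
Proof.
case: f g => [f Pf] [g Pg] /= fg.
have {fg} efg : f = g by apply: functional_extensionality_dep.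
by case: _ / efg Pg => Pg; congr DSum; exact: Prop_irrelevance.
Qed.

Lemma dsum_zero_fin : finite_set [set i | (0 : V i) != 0].
Proof. by apply: sub_finite_set (finite_set0 I) => i /=; rewrite eqxx. Qed.

Lemma dsum_opp_fin (f : dsum) : finite_set [set i | - f i != 0].
Proof. by apply: sub_finite_set (dsum_fin f) => i /=; rewrite oppr_eq0. Qed.

Lemma dsum_add_fin (f g : dsum) : finite_set [set i | f i + g i != 0].
Proof.
have fin : finite_set ([set i | f i != 0] `|` [set i | g i != 0]).
  by rewrite finite_setU; split; exact: dsum_fin.
apply: sub_finite_set fin => i /= fg0.
have [f0|] := eqVneq (f i) 0; last by left.
by right; move: fg0; rewrite f0 add0r.
Qed.

Definition dsum_zero := DSum dsum_zero_fin.
Definition dsum_opp f := DSum (dsum_opp_fin f).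
Definition dsum_add f g := DSum (dsum_add_fin f g).

HB.instance Definition _ := gen_eqMixin dsum.
HB.instance Definition _ := gen_choiceMixin dsum.

Lemma dsum_addA : associative dsum_add.
Proof. by move=> f g h; apply: dsumP => i /=; rewrite addrA. Qed.
Lemma dsum_addC : commutative dsum_add.
Proof. by move=> f g; apply: dsumP => i /=; rewrite addrC. Qed.
Lemma dsum_add0 : left_id dsum_zero dsum_add.
Proof. by move=> f; apply: dsumP => i /=; rewrite add0r. Qed.
Lemma dsum_addN : left_inverse dsum_zero dsum_opp dsum_add.
Proof. by move=> f; apply: dsumP => i /=; rewrite addNr. Qed.

HB.instance Definition _ :=
  GRing.isZmodule.Build dsum dsum_addA dsum_addC dsum_add0 dsum_addN.

End DirectSum.

Record skew_system (G : category) := SkewSystem {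
  fiber :> G -> nzRingType;
  sigma : forall x y : G, hom x y -> {rmorphism fiber x -> fiber y};
  sigma_id : forall (e : G) (a : fiber e), sigma (idm e) a = a;
  sigma_comp : forall (x y z : G) (m : hom y z) (n : hom x y) (a : fiber x),
    sigma m (sigma n a) = sigma (compm m n) a }.

Section SkewCategoryAlgebra.
Variables (G : category) (S : skew_system G).

Definition coeff_ring := dsum (fun e : G => S e : zmodType).

Lemma coeff_mul_fin (a b : coeff_ring) : finite_set [set e | a e * b e != 0].
Proof.
apply: sub_finite_set (dsum_fin a) => e /=.
by apply: contra_neq => ->; rewrite mul0r.
Qed.

Definition coeff_mul (a b : coeff_ring) : coeff_ring :=
  DSum (coeff_mul_fin a b).

(* [x n] is the coefficient in A_{c(n)} of u_n. *)
Definition skew_algebra := dsum (fun n : mor G => S (cod n) : zmodType).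

Definition mul_term (x y : skew_algebra) (n : mor G) (p : factorization n) :
    S (cod n) :=
  x (Mor (lfact p)) * sigma S (lfact p) (y (Mor (rfact p))).

Lemma mul_term_neq0 (x y : skew_algebra) n (p : factorization n) :
  mul_term x y p != 0 ->
  ([set m | x m != 0] `*` [set m | y m != 0]) (factors p).
Proof.
rewrite /mul_term => xy0; split => /=; apply: contra_neq xy0 => ->.
  by rewrite mul0r.
by rewrite raddf0 mulr0.
Qed.

(* The sum over factorizations in [skew_mul] has finite support, so the
   finitely supported big operator computes it rather than defaulting to 0. *)
Lemma mul_term_fin (x y : skew_algebra) n :
  finite_set [set p : factorization n | mul_term x y p != 0].
Proof.
have fin := finite_setX (dsum_fin x) (dsum_fin y).
apply: (sub_finite_set (@mul_term_neq0 x y n)).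
by apply: finite_preimage fin => p q _ _; exact: factors_inj.
Qed.

Definition skew_mul_fun (x y : skew_algebra) (n : mor G) : S (cod n) :=
  \sum_(p \in [set: {classic factorization n}]) mul_term x y p.

Lemma skew_mul_fin (x y : skew_algebra) :
  finite_set [set n | skew_mul_fun x y n != 0].
Proof.
have fin := finite_setX (dsum_fin x) (dsum_fin y).
set X := _ `*` _ in fin.
have fact n : skew_mul_fun x y n != 0 ->
    exists p : factorization n, X (factors p).
  apply: contra_neqP => noX; apply: fsbig1 => p _.
  apply/eqP; apply: contra_notT noX => p0.
  by exists p; exact: mul_term_neq0 p0.
pose g (q : mor G * mor G) : option (mor G) :=
  if pselect (exists n (p : factorization n), factors p = q) is left e
  then Some (projT1 (cid e)) else None.
rewrite -(eq_finite_set card_some); apply: sub_finite_set (finite_image g fin).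
move=> _ [n /fact[p Xp] <-]; exists (factors p) => //.
rewrite /g; case: pselect => [e|]; last by case; exists n, p.
by case: cid => n' /= [p' /factors_mor ->].
Qed.

Definition skew_mul (x y : skew_algebra) : skew_algebra :=
  DSum (skew_mul_fin x y).

Definition is_identity (n : mor G) : Prop := exists e : G, n = Mor (idm e).

Lemma embed_fin (a : coeff_ring) :
  finite_set [set n | (if `[< is_identity n >] then a (cod n) else 0) != 0].
Proof.
have fin := finite_image (fun e : G => Mor (idm e)) (dsum_fin a).
apply: sub_finite_set fin => n /=.
by case: asboolP => [[e ->]|_ /eqP//]; exists e.
Qed.

Definition embed (a : coeff_ring) : skew_algebra := DSum (embed_fin a).

Definition coeff_commutative : Prop := commutative coeff_mul.

(* [skew_algebra] has no identity element when G has infinitely many objects,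
   so ideals are described by hand instead of through a ring structure. *)
Definition two_sided_ideal (J : set skew_algebra) : Prop :=
  [/\ J 0, (forall x y, J x -> J y -> J (x - y)) &
      forall r x, J x -> J (skew_mul r x) /\ J (skew_mul x r)].

Definition commutant (B : set skew_algebra) : set skew_algebra :=
  [set x | forall y, B y -> skew_mul x y = skew_mul y x].

Definition maximal_commutative (B : set skew_algebra) : Prop :=
  (forall x y, B x -> B y -> skew_mul x y = skew_mul y x) /\ B = commutant B.

Definition ideals_meet_coeff : Prop :=
  forall J : set skew_algebra, two_sided_ideal J -> J <> [set 0] ->
    J `&` range embed <> [set 0].

Definition coeff_maximal_commutative : Prop :=
  maximal_commutative (range embed).

End SkewCategoryAlgebra.

(* Main.v *)
(** (a) The ring A x G acts on the families (b_e) by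
    (a_n u_n) . b = a_n sigma_n(b_{d(n)}), placed at c(n), and the kernel of
    this action meets A only in 0.  If x commutes with A and x_n <> 0, then n
    is a loop and x_n sigma_n(b) = b x_n, so x_n u_n - x_n u_e (e = c(n)) lies
    in the kernel; it is nonzero unless n is an identity.
    (b) For the category with one non-identity arrow n : e -> f and constant
    coefficients Z, the algebra is that of triangular 2x2 matrices: A is the
    diagonal, and the strictly triangular matrices form an ideal missing A.
    (c) Let x be a nonzero element of an ideal I, with x_n <> 0.  As n is
    invertible, x u_{n^-1} has support no larger than that of x, and a nonzero
    coefficient at the identity of c(n).  A commutator of it with a in A loses
    that coefficient, so has strictly smaller support; by induction on the
    support, I meets A unless all these commutators vanish, and then
    x u_{n^-1} itself is in A by maximality. *)

From mathcomp Require Import all_boot all_algebra.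
From mathcomp Require Import boolp classical_sets.
From mathcomp Require Import cardinality fsbigop.
Require Import Defs.

Set Implicit Arguments.
Unset Strict Implicit.
Unset Printing Implicit Defensive.

Import GRing.Theory.
Local Open Scope classical_set_scope.
Local Open Scope ring_scope.

(** * Finitely supported sums and additive maps *)

(* Unlike [fsbig_split], only the supports are finite, not the index type. *)
Lemma fsum_split (T : choiceType) (R : zmodType) (f g : T -> R) :
  finite_set [set i | f i != 0] -> finite_set [set i | g i != 0] ->
  \sum_(i \in [set: T]) (f i + g i) =
    \sum_(i \in [set: T]) f i + \sum_(i \in [set: T]) g i.
Proof.
move=> finf fing; pose D := [set i | f i != 0] `|` [set i | g i != 0].
have DT (h : T -> R) : (forall i, h i != 0 -> D i) ->
    \sum_(i \in [set: T]) h i = \sum_(i \in D) h i.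
  move=> hD; apply/esym/fsbig_widen => // i [_ Di].
  by apply: contrapT => /eqP /hD.
rewrite !DT; first by apply: fsbig_split; rewrite finite_setU.
- by move=> i gi; right.
- by move=> i fi; left.
- move=> i fgi; have [f0|f0] := eqVneq (f i) 0; last by left.
  by right; move: fgi; rewrite f0 add0r.
Qed.

Lemma fsum_single (T : choiceType) (R : zmodType) (f : T -> R) (i : T) :
  (forall j, f j != 0 -> j = i) -> \sum_(j \in [set: T]) f j = f i.
Proof.
move=> fi; rewrite -(fsbig_set1 +%R i f); apply/esym/fsbig_widen => // j [_ ji].
by apply: contrapT => /eqP /fi.
Qed.

Lemma addf_morph0 (U V : zmodType) (f : U -> V) :
  {morph f : x y / x + y} -> f 0 = 0.
Proof. by move=> fD; apply: (@addrI _ (f 0)); rewrite -fD !addr0. Qed.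

Lemma addf_morphB (U V : zmodType) (f : U -> V) :
  {morph f : x y / x + y} -> {morph f : x y / x - y}.
Proof. by move=> fD x y; apply/eqP; rewrite -subr_eq opprK -fD subrK. Qed.

(** * Elements of a direct sum supported at one index *)

Section Single.
Variables (I : Type) (V : I -> zmodType).

Lemma dsumB (f g : dsum V) i : (f - g) i = f i - g i.
Proof. by []. Qed.

(** The summand [V j] depends on the index, so [v] is transported along [i = j]; this equality is
    decided classically, as [I] is an arbitrary type. *)
Definition single_fun (i : I) (v : V i) (j : I) : V j :=
  if pselect (i = j) is left e then ecast k (V k) e v else 0.

Lemma single_fin i (v : V i) : finite_set [set j | single_fun v j != 0].
Proof.
apply: sub_finite_set (finite_set1 i) => j /=; rewrite /single_fun.
by case: pselect => [e _|_ /eqP//]; exact: esym.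
Qed.

Definition single i (v : V i) : dsum V := DSum (single_fin v).

Lemma singleE i (v : V i) : single v i = v.
Proof.
rewrite /single /= /single_fun; case: pselect => // e.
by rewrite (Prop_irrelevance e erefl).
Qed.

Lemma single_neq0 i (v : V i) j : single v j != 0 -> i = j.
Proof. by rewrite /single /= /single_fun; case: pselect => //; rewrite eqxx. Qed.

Lemma single_neq i (v : V i) j : i <> j -> single v j = 0.
Proof. by move=> ij; apply: contrapT => /eqP /single_neq0. Qed.

Lemma single0 i : single (0 : V i) = 0.
Proof.
by apply: dsumP => j; rewrite /single /= /single_fun; case: pselect => // e; case: _ / e.
Qed.

Lemma singleD i : {morph @single i : v w / v + w}.
Proof.
move=> v w; apply: dsumP => j; rewrite /single /= /single_fun.
by case: pselect => [e|]; [case: _ / e | rewrite addr0].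
Qed.

Lemma dsum_seq (f : dsum V) :
  exists s : seq {classic I}, forall i, f i != 0 -> (i : {classic I}) \in s.
Proof.
have /(@finite_seqP {classic I})[s fs] := dsum_fin f.
by exists s => i fi; have : [set` s] i by rewrite -fs.
Qed.

(** Induction on a list containing the support: subtracting [single (f i)] for the head [i] leaves
    an element supported in the tail. *)
Lemma dsum_ind (P : dsum V -> Prop) :
  P 0 -> (forall f g, P f -> P g -> P (f + g)) ->
  (forall i (v : V i), P (single v)) -> forall f, P f.
Proof.
move=> P0 PD P1 f; have [s] := dsum_seq f.
elim: s f => [|i s IHs] f fs.
  suff -> : f = 0 by [].
  by apply: dsumP => i; apply: contrapT => /eqP /fs.
rewrite -[f](subrK (single (f i))); apply: (PD) => //; apply: IHs => j.
have [<-|ij] := pselect (i = j); first by rewrite dsumB singleE subrr eqxx.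
rewrite dsumB (single_neq _ ij) subr0 => /fs.
by rewrite inE => /orP[/eqP /esym|].
Qed.

End Single.
Arguments single : simpl never.

(** * Multiplication in the skew category algebra, on monomials and by elements of A *)

Section SkewAlgebra.
Variables (G : category) (S : skew_system G).
Implicit Types (x y z : skew_algebra S) (a b : coeff_ring S).

Local Notation mono p c :=
  (@single (mor G) (fun n => S (cod n)) (Mor p) c : skew_algebra S).

Lemma skew_algebra_ind (P : skew_algebra S -> Prop) :
  P 0 -> (forall x y, P x -> P y -> P (x + y)) ->
  (forall (u v : G) (p : hom u v) (c : S v), P (mono p c)) -> forall x, P x.
Proof. by move=> P0 PD P1; apply: dsum_ind => // -[]. Qed.

Lemma skew_mulDl y : {morph (@skew_mul G S)^~ y : x x' / x + x'}.
Proof.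
move=> x x'; apply: dsumP => n.
rewrite [LHS]/= [RHS]/= /skew_mul_fun -fsum_split; last 2 first.
- exact: mul_term_fin.
- exact: mul_term_fin.
by apply: eq_fsbigr => p _; rewrite /mul_term mulrDl.
Qed.

Lemma skew_mulDr x : {morph skew_mul x : y y' / y + y'}.
Proof.
move=> y y'; apply: dsumP => n.
rewrite [LHS]/= [RHS]/= /skew_mul_fun -fsum_split; last 2 first.
- exact: mul_term_fin.
- exact: mul_term_fin.
by apply: eq_fsbigr => p _; rewrite /mul_term raddfD mulrDr.
Qed.

Lemma skew_mul0l y : skew_mul 0 y = 0.
Proof. exact: addf_morph0 (skew_mulDl y). Qed.

Lemma skew_mul0r x : skew_mul x 0 = 0.
Proof. exact: addf_morph0 (skew_mulDr x). Qed.

Lemma mul_term_supp x y n (p : factorization n) : mul_term x y p != 0 ->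
  x (Mor (lfact p)) != 0 /\ y (Mor (rfact p)) != 0.
Proof. by move/mul_term_neq0 => -[]. Qed.

Lemma skew_mul_neq0 x y n : skew_mul x y n != 0 ->
  exists p : factorization n, x (Mor (lfact p)) != 0 /\ y (Mor (rfact p)) != 0.
Proof.
apply: contra_neqP => nop; apply: fsbig1 => p _; apply: contrapT => /eqP.
by move/mul_term_supp => [? ?]; apply: nop; exists p.
Qed.

Lemma skew_mul_mono (u v w : G) (p : hom v w) (q : hom u v) (c : S w) (d : S v) :
  skew_mul (mono p c) (mono q d) = mono (compm p q) (c * sigma S p d).
Proof.
pose r0 : {classic factorization (Mor (compm p q))} :=
  @Factorization G (Mor (compm p q)) v p q erefl.
apply: dsumP => n; have [<-|npq] := pselect (Mor (compm p q) = n).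
  rewrite singleE /= /skew_mul_fun (@fsum_single _ _ _ r0); last first.
    move=> r /mul_term_supp[rp rq]; apply: factors_inj.
    by rewrite /factors -(single_neq0 rp) -(single_neq0 rq).
  by rewrite /mul_term !singleE.
rewrite (single_neq _ npq); apply: contrapT => /eqP /skew_mul_neq0.
move=> [r [rp rq]]; apply: npq; apply: (@factors_mor _ _ _ r0 r).
by rewrite /factors -(single_neq0 rp) -(single_neq0 rq).
Qed.

Lemma skew_mul_mono0 (u v v' w : G) (p : hom v' w) (q : hom u v) (c : S w)
    (d : S v) :
  v' <> v -> skew_mul (mono p c) (mono q d) = 0.
Proof.
move=> nv; apply: dsumP => n; apply: contrapT => /eqP /skew_mul_neq0.
move=> [r [rp rq]]; apply: nv.
have /= -> := congr1 (@dom G) (single_neq0 rp).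
by have /= -> := congr1 (@cod G) (single_neq0 rq).
Qed.

Lemma embed_id a (e : G) : embed a (Mor (idm e)) = a e.
Proof. by rewrite /=; case: asboolP => // -[]; exists e. Qed.

Lemma embed_neq0 a (n : mor G) : embed a n != 0 -> is_identity n.
Proof. by rewrite /=; case: asboolP => //; rewrite eqxx. Qed.

Lemma embed_nid a (n : mor G) : ~ is_identity n -> embed a n = 0.
Proof. by rewrite /=; case: asboolP. Qed.

(** A factorization of [n] whose left factor is an identity must be [idm v] followed by [n] itself,
    so a single term survives. *)
Lemma mul_embedl a x n : skew_mul (embed a) x n = a (cod n) * x n.
Proof.
case: n => u v n.
pose r0 : {classic factorization (Mor n)} :=
  @Factorization G (Mor n) v (idm v) n (comp1m n).
rewrite /= /skew_mul_fun (@fsum_single _ _ _ r0).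
  by rewrite /mul_term embed_id sigma_id.
case=> k l r /= e /mul_term_supp[/embed_neq0 /= [k' el] _].
have [/= ek ev] := (congr1 (@dom G) el, congr1 (@cod G) el).
by subst k k'; move: (Mor_inj el) => ?; subst l; apply: factors_inj;
  rewrite /factors /= -e comp1m.
Qed.

Lemma mul_embedr a x n :
  skew_mul x (embed a) n = x n * sigma S (arr n) (a (dom n)).
Proof.
case: n => u v n.
pose r0 : {classic factorization (Mor n)} :=
  @Factorization G (Mor n) u n (idm u) (compm1 n).
rewrite /= /skew_mul_fun (@fsum_single _ _ _ r0).
  by rewrite /mul_term embed_id.
case=> k l r /= e /mul_term_supp[_ /embed_neq0 /= [k' er]].
have [/= eu ek] := (congr1 (@dom G) er, congr1 (@cod G) er).
by subst k k'; move: (Mor_inj er) => ?; subst r; apply: factors_inj;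
  rewrite /factors /= -e compm1.
Qed.

(** * The commutant of A *)

Lemma coeff_commP : coeff_commutative S ->
  forall (e : G), commutative (@GRing.mul (S e)).
Proof.
move=> comS e c d.
pose s (c : S e) : coeff_ring S := @single G (fun e => S e) e c.
have : s c e * s d e = s d e * s c e.
  by have /(congr1 (fun f : coeff_ring S => dsum_fun f e)) := comS (s c) (s d).
by rewrite !singleE.
Qed.

Lemma embed_eq x : (forall n, x n != 0 -> is_identity n) -> range (@embed G S) x.
Proof.
move=> xid.
have fin : finite_set [set e | x (Mor (idm e)) != 0].
  apply: finite_preimage (dsum_fin x).
  by move=> e e' _ _ /(congr1 (@dom G)).
exists (@DSum _ (fun e : G => S e) (fun e => x (Mor (idm e))) fin) => //.
apply: dsumP => n; have [[e ->]|nid] := pselect (is_identity n).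
  by rewrite embed_id.
have -> : x n = 0 by apply: contrapT => /eqP /xid.
by rewrite embed_nid.
Qed.

Lemma commutant_embedP x : commutant (range (@embed G S)) x ->
  forall n a, x n * sigma S (arr n) (a (dom n)) = a (cod n) * x n.
Proof.
move=> xC n a; rewrite -mul_embedr -mul_embedl.
by rewrite (xC (embed a)) //; exists a.
Qed.

(** Commutation is tested on the unit of the summand at [dom n]: if [n] is not a loop, this element
    vanishes at [cod n], which forces [x n = 0]. *)
Lemma commutant_loop x n : commutant (range (@embed G S)) x ->
  x n != 0 -> dom n = cod n.
Proof.
move=> xC; apply: contra_neqP => nloop.
pose a : coeff_ring S := @single G (fun e => S e) (dom n) 1.
have := commutant_embedP xC n a.
by rewrite /a singleE (single_neq _ nloop) rmorph1 mulr1 mul0r.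
Qed.

(** Products inside A are componentwise, so A is commutative, and only the supports of elements of
    its commutant remain to be controlled. *)
Lemma coeff_maximal_commutativeP : coeff_commutative S ->
  (forall x, commutant (range (@embed G S)) x ->
     forall n, x n != 0 -> is_identity n) ->
  coeff_maximal_commutative S.
Proof.
move=> comS maxS.
have comA x y : range (@embed G S) x -> range (@embed G S) y ->
    skew_mul x y = skew_mul y x.
  move=> [a _ <-] [b _ <-]; apply: dsumP => n; rewrite !mul_embedl.
  have [[e ->]|nid] := pselect (is_identity n).
    by rewrite !embed_id (coeff_commP comS).
  by rewrite !(embed_nid _ nid) !mulr0.
split=> //; apply/seteqP; split=> [x xA y yA|x xC]; first exact: comA.
by apply: embed_eq => n; exact: maxS xC n.
Qed.

(** * The action on families, its kernel, and assertion (a) *)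

Definition act_term x (b : forall e : G, S e) (c : G)
    (p : {d : G & hom d c}) : S c :=
  x (Mor (projT2 p)) * sigma S (projT2 p) (b (projT1 p)).

(** The sum runs over all arrows into [c]. Families lie in the full product of the fibers, so the
    constant family 1 is available even with infinitely many objects. *)
Definition act x (b : forall e : G, S e) (c : G) : S c :=
  \sum_(p \in [set: {classic {d : G & hom d c}}]) act_term x b p.

Lemma act_fin x (b : forall e : G, S e) (c : G) :
  finite_set [set p : {d : G & hom d c} | act_term x b p != 0].
Proof.
have fin : finite_set [set p : {d : G & hom d c} | x (Mor (projT2 p)) != 0].
  apply: finite_preimage (dsum_fin x).
  move=> [d n] [d' n'] _ _ /= e; have /= ed := congr1 (@dom G) e.
  by subst d'; rewrite (Mor_inj e).
by apply: sub_finite_set fin => p; rewrite /= /act_term; apply: contra_neq => ->; rewrite mul0r.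
Qed.

Lemma actDl (b : forall e : G, S e) (c : G) : {morph (fun x => act x b c) : x y / x + y}.
Proof.
move=> x y; rewrite /act -fsum_split; last 2 first.
- exact: act_fin.
- exact: act_fin.
by apply: eq_fsbigr => p _; rewrite /act_term mulrDl.
Qed.

Lemma act0l (b : forall e : G, S e) (c : G) : act 0 b c = 0.
Proof. exact: addf_morph0 (actDl b c). Qed.

Lemma act_mono (u v : G) (p : hom u v) r (b : forall e, S e) (c : G) :
  act (mono p r) b c = @single G (fun e => S e) v (r * sigma S p (b u)) c.
Proof.
have [<-|nvc] := pselect (v = c).
  pose p0 : {classic {d : G & hom d v}} := existT _ u p.
  rewrite singleE /act (@fsum_single _ _ _ p0); last first.
    case=> [d q] rq0.
    have pq : mono p r (Mor q) != 0.
      by apply: contra_neq rq0 => pq0; rewrite /act_term [X in X * _]pq0 mul0r.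
    have e := single_neq0 pq.
    have /= ed := congr1 (@dom G) e; subst d.
    by rewrite /p0 (Mor_inj e).
  by rewrite /act_term singleE.
rewrite (single_neq _ nvc); apply: fsbig1 => -[d q] _.
by rewrite /act_term single_neq ?mul0r // => /(congr1 (@cod G)).
Qed.

(** Both sides are additive in [x] and in [y], which reduces the claim to monomials. There it is
    functoriality of sigma if the arrows compose; otherwise both sides vanish. *)
Lemma act_mul x y (b : forall e : G, S e) (c : G) :
  act (skew_mul x y) b c = act x (act y b) c.
Proof.
elim/skew_algebra_ind: x c => [c|x x' IH IH' c|v w p r c].
- by rewrite skew_mul0l !act0l.
- by rewrite skew_mulDl !actDl IH IH'.
rewrite act_mono.
elim/skew_algebra_ind: y c => [c|y y' IH IH' c|u v' q s c].
- by rewrite skew_mul0r !act0l rmorph0 mulr0 single0.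
- by rewrite skew_mulDr !actDl IH IH' rmorphD mulrDr singleD.
have [e|vv'] := pselect (v = v').
  subst v'; rewrite skew_mul_mono !act_mono singleE rmorphM sigma_comp.
  by rewrite mulrA.
rewrite skew_mul_mono0 // act0l act_mono (single_neq _ (nesym vv')).
by rewrite rmorph0 mulr0 single0.
Qed.

Lemma act_eq0r x (b : forall e : G, S e) (c : G) :
  (forall e, b e = 0) -> act x b c = 0.
Proof. by move=> b0; apply: fsbig1 => p _; rewrite /act_term b0 raddf0 mulr0. Qed.

Lemma act_embed a (b : forall e : G, S e) (c : G) : act (embed a) b c = a c * b c.
Proof.
pose p0 : {classic {d : G & hom d c}} :=
  existT (fun d => hom d c) c (idm c).
rewrite /act (@fsum_single _ _ _ p0).
  by rewrite /act_term [projT2 _]/= [projT1 _]/= embed_id sigma_id.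
case=> [d q] q0.
have /embed_neq0 [e /= eq] : embed a (Mor q) != 0.
  by apply: contra_neq q0 => q0; rewrite /act_term [X in X * _]q0 mul0r.
have [/= ed ec] := (congr1 (@dom G) eq, congr1 (@cod G) eq).
by subst d e; rewrite /p0 (Mor_inj eq).
Qed.

Definition act_kernel : set (skew_algebra S) :=
  [set x | forall (b : forall e : G, S e) (c : G), act x b c = 0].

Lemma act_kernel_ideal : two_sided_ideal act_kernel.
Proof.
split=> [b c|x y x0 y0 b c|r x x0]; first exact: act0l.
  by rewrite (addf_morphB (actDl b c)) x0 y0 subr0.
by split=> b c; rewrite act_mul ?x0 // act_eq0r.
Qed.

Lemma act_kernel_embed : act_kernel `&` range (@embed G S) = [set 0].
Proof.
apply/seteqP; split=> [_ [/[swap] -[a _ <-] x0]|_ ->].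
  suff -> : a = 0 by apply: dsumP => n /=; case: asboolP.
  (* The constant family 1 recovers every coefficient of [a]. *)
  by apply: dsumP => c; have := x0 (fun=> 1) c; rewrite act_embed mulr1.
split; first by case: act_kernel_ideal.
by exists 0 => //; apply: dsumP => n /=; case: asboolP.
Qed.

Lemma maximal_commutative_of_ideals : coeff_commutative S ->
  ideals_meet_coeff S -> coeff_maximal_commutative S.
Proof.
move=> comS meetS; apply: coeff_maximal_commutativeP => // x xC n xn.
have loop := commutant_loop xC xn; case: n loop xn => [e f n] /= ef; subst f.
move=> xn; apply: contrapT => nid.
pose r : S e := x (Mor n).
apply: (meetS act_kernel act_kernel_ideal); last exact: act_kernel_embed.
pose y := mono n r - mono (idm e) r.
have yJ : act_kernel y.
  move=> b c; rewrite (addf_morphB (actDl b c)) !act_mono sigma_id.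
  (* At the object [e] the two monomials of [y] contribute [r * sigma_n(b e)] and [r * b e];
     commutation of [x] with [b e] placed at [e] makes them equal. *)
  have := commutant_embedP xC (Mor n) (@single G (fun e => S e) e (b e)).
  by rewrite !singleE (coeff_commP comS (b e)) -/r /= => ->; rewrite subrr.
move=> J0; move: yJ; rewrite J0 => /= y0.
have : y (Mor n) = 0 by rewrite y0.
rewrite /y dsumB singleE single_neq ?subr0; first exact/eqP.
by move=> en; apply: nid; exists e.
Qed.

End SkewAlgebra.

(** * Shrinking supports in an ideal over a groupoid, for assertion (c) *)

Section Groupoid.
Variables (G : category) (S : skew_system G).
Hypotheses (groupoidG : is_groupoid G) (comS : coeff_commutative S).
Variable J : set (skew_algebra S).
Hypothesis idealJ : two_sided_ideal J.

Local Notation mono p c :=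
  (@single (mor G) (fun n => S (cod n)) (Mor p) c : skew_algebra S).

Lemma skew_mul_inv (x : skew_algebra S) (d c : G) (n : hom d c) (m : hom c d) :
  compm m n = idm d -> compm n m = idm c ->
  skew_mul x (mono m 1) (Mor (idm c)) = x (Mor n).
Proof.
move=> mn nm.
pose r0 : {classic factorization (Mor (idm c))} :=
  @Factorization G (Mor (idm c)) d n m nm.
rewrite /= /skew_mul_fun (@fsum_single _ _ _ r0).
  by rewrite /mul_term singleE rmorph1 mulr1.
case=> k l r /= e /mul_term_supp[_ /= rm].
have em := single_neq0 rm; have /= ek := congr1 (@cod G) em; subst k.
apply: factors_inj; rewrite /factors /= -(Mor_inj em).
(* The left factor is forced: l = l(mn) = (lm)n = n. *)
by rewrite -[l]compm1 -mn compmA (Mor_inj em) e comp1m.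
Qed.

(** Right multiplication by a monomial at [m] carries the support along the partial map p to pm, so
    a list covering the support need not grow. *)
Lemma skew_mul_mono_supp (x : skew_algebra S) (c d : G) (m : hom c d) (r : S d)
    (s : seq {classic mor G}) :
  (forall n, x n != 0 -> (n : {classic mor G}) \in s) ->
  exists2 s' : seq {classic mor G}, size s' = size s &
    forall n, skew_mul x (mono m r) n != 0 -> (n : {classic mor G}) \in s'.
Proof.
move=> xs.
(* [g p] is the composite of [p] with [m], or the default [p] when they do not compose. *)
pose g (p : {classic mor G}) : {classic mor G} :=
  if pselect (exists n (q : factorization n), factors q = (p, Mor m)) is left e
  then projT1 (cid e) else p.
exists (map g s); rewrite ?size_map // => n /skew_mul_neq0[p [xp mp]].
have -> : (n : {classic mor G}) = g (Mor (lfact p)).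
  have pm : factors p = (Mor (lfact p), Mor m) by rewrite (single_neq0 mp).
  rewrite /g; case: pselect => [e|]; last by case; exists n, p.
  by case: cid => n' /= [q pq]; apply: (@factors_mor _ _ _ p q); rewrite pm pq.
exact/map_f/xs.
Qed.

Lemma ideal_meets_coeff (s : seq {classic mor G}) (x : skew_algebra S) :
  coeff_maximal_commutative S -> J x -> x <> 0 ->
  (forall n, x n != 0 -> (n : {classic mor G}) \in s) ->
  exists y, [/\ J y, range (@embed G S) y & y <> 0].
Proof.
move=> [_ maxS]; have [k] := ubnP (size s); elim: k s x => // k IHk s x sk Jx x0 xs.
have [n xn] : exists n, x n != 0.
  apply: contrapT => nx; apply: x0; apply: dsumP => n; apply: contrapT => /eqP xn.
  by apply: nx; exists n.
case: n xn => [d c n] xn; have [m [mn nm]] := groupoidG n.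
have [_ JB JM] := idealJ.
pose x' := skew_mul x (mono m 1).
have Jx' : J x' by have [] := JM (mono m 1) x Jx.
have x'n : x' (Mor (idm c)) != 0 by rewrite /x' (skew_mul_inv x mn nm).
have [s' s's x's'] := @skew_mul_mono_supp x c d m 1 s xs.
have [x'A|] := pselect (range (@embed G S) x').
  by exists x'; split=> // x'0; move: x'n; rewrite x'0 eqxx.
(* By maximality, an element outside A fails to commute with some [embed a]. *)
rewrite [in X in X -> _]maxS => nC.
have [a za] : exists a, skew_mul x' (embed a) - skew_mul (embed a) x' <> 0.
  apply: contrapT => nz; apply: nC => _ [a _ <-]; apply: contrapT => xa.
  by apply: nz; exists a => /subr0_eq.
pose s'' := rem (Mor (idm c) : {classic mor G}) s'.
apply: (IHk s'' _ _ _ za).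
- have s'n := x's' _ x'n; rewrite size_rem // -ltnS prednK ?s's //.
  by rewrite -s's; case: (s') s'n.
- by apply: JB; have [] := JM (embed a) x' Jx'.
move=> n' z0; apply: rem_mem; last first.
  apply: x's'; apply: contra_neq z0 => x'n'.
  by rewrite dsumB mul_embedl mul_embedr x'n' mul0r mulr0 subrr.
apply: contra_neq z0 => ->.
by rewrite dsumB mul_embedl mul_embedr sigma_id (coeff_commP comS) subrr.
Qed.

End Groupoid.

Lemma ideals_meet_of_maximal_commutative (G : category) (S : skew_system G) :
  is_groupoid G -> coeff_commutative S -> coeff_maximal_commutative S ->
  ideals_meet_coeff S.
Proof.
move=> gG comS maxS J idealJ Jn0 JA.
have [x Jx x0] : exists2 x, J x & x <> 0.
  apply: contrapT => nx; apply: Jn0; apply/seteqP; split=> [x Jx|_ ->].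
    by apply: contrapT => x0; apply: nx; exists x.
  by case: idealJ.
have [s xs] := dsum_seq x.
have [y [Jy yA]] := ideal_meets_coeff gG comS idealJ maxS Jx x0 xs.
by apply; have : (J `&` range (@embed G S)) y by []; rewrite JA.
Qed.

(** * The triangular counterexample for assertion (b) *)

Section UpperTriangular.

Lemma implyb_refl b : b ==> b. Proof. by case: b. Qed.

Lemma implyb_comp b1 b2 b3 : b2 ==> b3 -> b1 ==> b2 -> b1 ==> b3.
Proof. by case: b1; case: b2; case: b3. Qed.

(** The order false <= true as a category: arrows are proofs of a boolean implication, so parallel
    arrows are equal and the laws hold by irrelevance. *)
Definition arrow_category : category :=
  @Category bool (fun b c => b ==> c) implyb_refl implyb_comp
    (fun _ _ _ => bool_irrelevance _ _) (fun _ _ _ => bool_irrelevance _ _)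
    (fun _ _ _ _ _ _ _ => bool_irrelevance _ _).

Definition triangular_system : skew_system arrow_category :=
  @SkewSystem arrow_category (fun=> int) (fun _ _ _ => idfun)
    (fun _ _ => erefl) (fun _ _ _ _ _ _ => erefl).

Local Notation TS := triangular_system.

Definition strict_ideal : set (skew_algebra TS) :=
  [set x | forall e : arrow_category, x (Mor (idm e)) = 0].

Lemma strict_ideal_two_sided : two_sided_ideal strict_ideal.
Proof.
(* An identity factors only through identities, since arrows both ways between [k] and [e] force
   [k = e]. *)
have id_fact (e k : arrow_category) (l : hom k e) (r : hom e k) :
    Mor l = Mor (idm e) /\ Mor r = Mor (idm e).
  have ke : k = e by move: l r; case: k; case: e.
  by subst k; split; congr Mor; exact: bool_irrelevance.
split=> [//|x y x0 y0 e|r x x0]; first by rewrite dsumB x0 y0 subrr.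
by split=> e; apply: contrapT => /eqP /skew_mul_neq0[p] [];
  have [/= -> ->] := id_fact _ _ (lfact p) (rfact p); rewrite x0 eqxx.
Qed.

Lemma triangular_counterexample :
  [/\ coeff_commutative TS, coeff_maximal_commutative TS & ~ ideals_meet_coeff TS].
Proof.
have comS : coeff_commutative TS.
  by move=> a b; apply: dsumP => e /=; exact: mulrC.
split=> //.
  (* The commutant is supported on loops, and every loop here is an identity. *)
  apply: coeff_maximal_commutativeP => // x xC [d c n] /(commutant_loop xC) /= dc.
  by subst c; exists d; congr Mor; exact: bool_irrelevance.
move=> /(_ strict_ideal strict_ideal_two_sided); apply.
  (* The monomial at the unique non-identity arrow is a nonzero element of the ideal. *)
  pose n : mor arrow_category := @Mor arrow_category false true isT.
  pose x : skew_algebra TS := @single _ (fun n => TS (cod n)) n 1.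
  move=> J0; have xJ : strict_ideal x by move=> e; apply: single_neq => -[]; case: e.
  move: xJ; rewrite J0 => /= x0.
  have : x n = 0 by rewrite x0.
  by rewrite /x singleE => /eqP; rewrite oner_eq0.
apply/seteqP; split=> [_ [/[swap] -[a _ <-] x0]|_ ->].
  apply: dsumP => n; have [[e ->]|nid] := pselect (is_identity n); first exact: x0.
  exact: embed_nid.
by split=> //; exists 0 => //; apply: dsumP => n /=; case: asboolP.
Qed.

End UpperTriangular.

Theorem proposition12 :
  (forall (G : category) (S : skew_system G),
     coeff_commutative S ->
     ideals_meet_coeff S -> coeff_maximal_commutative S) /\
  (exists (G : category) (S : skew_system G),
     [/\ coeff_commutative S,
         coeff_maximal_commutative S & ~ ideals_meet_coeff S]) /\
  (forall (G : category) (S : skew_system G),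
     coeff_commutative S -> is_groupoid G ->
     (ideals_meet_coeff S <-> coeff_maximal_commutative S)).
Proof.
split; first exact: maximal_commutative_of_ideals.
split; first by exists arrow_category, triangular_system; exact: triangular_counterexample.
move=> G S comS gG; split; first exact: maximal_commutative_of_ideals.
exact: ideals_meet_of_maximal_commutative.
Qed.
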